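(* Let $A$ be a finite-dimensional self-injective $\mathbb{K}$-algebra such that $\Omega^3_{A^e}(A)\cong{}_\mu A_{\mathrm{id}}$ as bimodules for some automorphism $\mu$ of $A$, let $\eta$ be a Nakayama automorphism of $A$, and put $\gamma=\eta^{-1}\circ\mu$. Let $X,Y\in\mathrm{mod}\,A$ and assume that $Y$ is $\gamma$-equivariant, i.e. ${}_\gamma Y\cong Y$. Then $$D\,\mathrm{Ext}^1_A(Y,X)\cong\mathrm{Ext}^1_A(X,Y).$$
   Context: $\mathbb{K}$ is an algebraically closed field; $\mathrm{mod}\,A$ is the category of finite-dimensional left $A$-modules; $D=\mathrm{Hom}_{\mathbb{K}}(-,\mathbb{K})$. $A^e$ is the enveloping algebra (left $A^e$-modules are $A$-$A$-bimodules) and $\Omega_{A^e}$ the syzygy of bimodules. For an algebra automorphism $\varphi$ of $A$ and a left module $M$, ${}_\varphi M$ is the twist of $M$ by $\varphi$ ($a$ acts on ${}_\varphi M$ as $\varphi^{-1}(a)$ acts on $M$); the left action of the bimodule ${}_\varphi A_{\mathrm{id}}$ is twisted in the same way. A Nakayama automorphism $\eta$ of $A$ is an algebra automorphism with $D(A)\cong{}_{\eta^{-1}}A_{\mathrm{id}}$ as bimodules. *)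

(* Defs.v *)
From HB Require Import structures.
From mathcomp Require Import all_boot all_order all_algebra all_field.

Set Implicit Arguments.
Unset Strict Implicit.
Unset Printing Implicit Defensive.

Import GRing.Theory.
Local Open Scope ring_scope.

Section Quotient.
Variables (K : fieldType) (V : vectType K) (W : {vspace V}).

(* MathComp has no quotient vector spaces.  The model of V / W used here is a
   complement of W, with the projection along W as canonical map; [quot_piP]
   is the characterization of the quotient. *)
Definition quot : vectType K := subvs_of (W^C)%VS.

Definition quot_pi : 'Hom(V, quot) :=
  linfun (vsproj (W^C)%VS \o daddv_pi (W^C)%VS W).

Lemma quot_piP : limg quot_pi = fullv /\ lker quot_pi = W.
Proof.
have dWC : (W^C :&: W = 0)%VS by rewrite capvC capv_compl.
have dW : (W :&: W^C = 0)%VS by rewrite capv_compl.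
split.
  apply/eqP; rewrite eqEsubv subvf; apply/subvP => u _.
  rewrite -[u]vsvalK -(daddv_pi_id dWC (subvsP u)).
  apply/memv_imgP; exists (vsval u); first exact: memvf.
  by rewrite lfunE /= !daddv_pi_id ?subvsP.
apply/eqP; rewrite eqEsubv; apply/andP; split; apply/subvP => v.
  rewrite memv_ker lfunE /= => /eqP /(congr1 vsval).
  rewrite vsprojK ?memv_pi // linear0 => v0.
  have vS : v \in (W + W^C)%VS by rewrite addv_complf memvf.
  by rewrite -(daddv_pi_add dW vS) v0 addr0 memv_pi.
move=> vW; rewrite memv_ker lfunE /=.
have vS : v \in (W^C + W)%VS by rewrite addvC addv_complf memvf.
have := daddv_pi_add dWC vS; rewrite (daddv_pi_id dW vW) => /(canRL (addrK _)).
by rewrite subrr => ->; rewrite linear0.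
Qed.

End Quotient.

Definition vdual (K : fieldType) (V : vectType K) : vectType K := 'Hom(V, K^o).

Definition viso (K : fieldType) (V W : vectType K) : Prop :=
  exists f : 'Hom(V, W), bijective f.

(* Algebra automorphisms, packaged with their inverse. *)
Record algaut (K : fieldType) (A : falgType K) := Algaut {
  aut_fun :> {lrmorphism A -> A};
  aut_invfun : {lrmorphism A -> A};
  aut_funK : cancel aut_fun aut_invfun;
  aut_invfunK : cancel aut_invfun aut_fun
}.

Section Automorphisms.
Variables (K : fieldType) (A : falgType K).

Definition aut_inv (f : algaut A) : algaut A :=
  Algaut (@aut_invfunK _ _ f) (@aut_funK _ _ f).

Definition aut_comp (f g : algaut A) : algaut A :=
  @Algaut _ _ (f \o g) (aut_inv g \o aut_inv f)
    (can_comp (@aut_funK _ _ f) (@aut_funK _ _ g))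
    (can_comp (@aut_invfunK _ _ g) (@aut_invfunK _ _ f)).

End Automorphisms.

(* Finite-dimensional left A-modules. *)
Record fdmod (K : fieldType) (A : falgType K) := Fdmod {
  mod_car :> vectType K;
  act : A -> mod_car -> mod_car;
  act_linl : forall x, linear (act^~ x);
  act_linr : forall a, linear (act a);
  act1 : forall x, act 1 x = x;
  actM : forall a b x, act (a * b) x = act a (act b x)
}.

Section Modules.
Variables (K : fieldType) (A : falgType K).
Implicit Types M N P X Y : fdmod A.

Definition is_hom M N (f : M -> N) : Prop :=
  forall a x, f (act a x) = act a (f x).

Definition mod_iso M N : Prop :=
  exists f : 'Hom(M, N), is_hom f /\ bijective f.

Definition mod_projective P : Prop :=
  forall M N (g : 'Hom(M, N)) (f : 'Hom(P, N)),
    is_hom g -> is_hom f -> limg g = fullv ->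
    exists h : 'Hom(P, M), is_hom h /\ (g \o h)%VF = f.

Definition mod_injective X : Prop :=
  forall M N (i : 'Hom(M, N)) (f : 'Hom(M, X)),
    is_hom i -> is_hom f -> lker i = 0%VS ->
    exists h : 'Hom(N, X), is_hom h /\ (h \o i)%VF = f.

Definition reg_mod : fdmod A.
Proof.
refine (@Fdmod K A A (fun a x => a * x) _ _ _ _).
- by move=> x k a b; rewrite mulrDl -scalerAl.
- by move=> a k x y; rewrite mulrDr -scalerAr.
- exact: mul1r.
- by move=> a b x; rewrite mulrA.
Defined.

(* a acts on the twist of M by phi as phi^-1 a acts on M. *)
Definition twist_mod (phi : algaut A) M : fdmod A.
Proof.
refine (@Fdmod K A M (fun a x => act (aut_inv phi a) x) _ _ _ _).
- by move=> x k a b; rewrite linearP act_linl.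
- by move=> a k x y; rewrite act_linr.
- by move=> x; rewrite rmorph1 act1.
- by move=> a b x; rewrite rmorphM actM.
Defined.

Definition free_mod (n : nat) : fdmod A.
Proof.
refine (@Fdmod K A {ffun 'I_n -> A} (fun a u => [ffun i => a * u i]) _ _ _ _).
- by move=> u k a b; apply/ffunP=> i; rewrite !ffunE mulrDl -scalerAl.
- by move=> a k u v; apply/ffunP=> i; rewrite !ffunE mulrDr -scalerAr.
- by move=> u; apply/ffunP=> i; rewrite !ffunE mul1r.
- by move=> a b u; apply/ffunP=> i; rewrite !ffunE mulrA.
Defined.

HB.instance Definition _ M a :=
  GRing.isLinear.Build K M M _ (@act K A M a) (@act_linr K A M a).

Lemma act_linlP M (x : M) k a b : act (k *: a + b) x = k *: act a x + act b x.
Proof. exact: act_linl. Qed.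

Lemma act0 M (x : M) : act 0 x = 0.
Proof.
by have := act_linlP x (-1) 0 0; rewrite scaler0 addr0 scaleN1r addNr.
Qed.

Lemma act_scalar M k (x : M) : act k%:A x = k *: x.
Proof. by have := act_linlP x k 1 0; rewrite !addr0 act0 addr0 act1. Qed.

Section Kernel.
Variables (M N : fdmod A) (f : 'Hom(M, N)) (fH : is_hom f).

Lemma act_lker a x : x \in lker f -> act a x \in lker f.
Proof.
by rewrite !memv_ker fH => /eqP ->; rewrite linear0.
Qed.

Definition ker_mod : fdmod A.
Proof.
refine (@Fdmod K A (subvs_of (lker f))
  (fun a x => vsproj (lker f) (act a (vsval x))) _ _ _ _).
- by move=> x k a b; rewrite act_linlP linearP.
- by move=> a k x y; rewrite !linearP.
- by move=> x; rewrite act1 vsvalK.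
- by move=> a b x; rewrite actM vsprojK ?act_lker ?subvsP.
Defined.

Definition ker_incl : 'Hom(ker_mod, M) :=
  linfun (vsval : subvs_of (lker f) -> M).

End Kernel.

Section FreeMap.
Variables (X : fdmod A) (n : nat) (e : 'I_n -> X).

Definition free_map_fun (u : free_mod n) : X :=
  \sum_(i < n) act ((u : {ffun 'I_n -> A}) i) (e i).

Fact free_map_linear : linear free_map_fun.
Proof.
move=> k u v; rewrite /free_map_fun scaler_sumr -big_split /=.
by apply: eq_bigr => i _; rewrite !ffunE act_linlP.
Qed.

HB.instance Definition _ :=
  GRing.isLinear.Build K (free_mod n) X _ free_map_fun free_map_linear.

Definition free_map : 'Hom(free_mod n, X) := linfun free_map_fun.

Lemma free_mapE (u : free_mod n) :
  free_map u = \sum_(i < n) act ((u : {ffun 'I_n -> A}) i) (e i).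
Proof. by rewrite lfunE. Qed.

Lemma free_map_hom : is_hom free_map.
Proof.
move=> a u; rewrite !free_mapE linear_sum.
by apply: eq_bigr => i _; rewrite ffunE actM.
Qed.

End FreeMap.

Definition free_gen n (i : 'I_n) : free_mod n :=
  [ffun j => (i == j)%:R] : {ffun 'I_n -> A}.

Lemma free_mod_ext n X (f g : 'Hom(free_mod n, X)) :
  is_hom f -> is_hom g -> (forall i, f (free_gen i) = g (free_gen i)) -> f = g.
Proof.
move=> fH gH fg; apply/lfunP=> u.
have -> : u = \sum_i act ((u : {ffun 'I_n -> A}) i) (free_gen i).
  apply/ffunP=> j; rewrite sum_ffunE (bigD1 j) //= big1 ?addr0 => [|i ij].
    by rewrite !ffunE eqxx mulr1.
  by rewrite !ffunE (negPf ij) mulr0.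
rewrite !linear_sum; apply: eq_bigr => i _.
rewrite -[LHS]/(f (act _ (free_gen i))) -[RHS]/(g (act _ (free_gen i))).
by rewrite fH gH fg.
Qed.

Lemma free_mod_projective n : mod_projective (free_mod n).
Proof.
move=> M N g f gH fH gS.
pose h := free_map (fun i => (g^-1)%VF (f (free_gen i)) : M).
exists h; split; first exact: free_map_hom.
apply: free_mod_ext => // [a u|i].
  by rewrite !comp_lfunE (@free_map_hom M) gH.
rewrite comp_lfunE free_mapE (bigD1 i) //= big1 => [|j ji].
  by rewrite ffunE eqxx act1 addr0 limg_lfunVK ?gS ?memvf.
by rewrite ffunE eq_sym (negPf ji) act0.
Qed.

(* The surjection A^(dim X) -> X given by a K-basis of X. *)
Definition free_cover X : 'Hom(free_mod (\dim {:X}), X) :=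
  free_map (fun i => (vbasis {:X})`_i).

Lemma free_cover_hom X : is_hom (free_cover X).
Proof. exact: free_map_hom. Qed.

Lemma free_cover_surj X : limg (free_cover X) = fullv.
Proof.
apply/eqP; rewrite eqEsubv subvf; apply/subvP => x _; apply/memv_imgP.
exists ([ffun i => (coord (vbasis {:X}) i x)%:A] : {ffun _ -> A}).
  exact: memvf.
rewrite free_mapE {1}(coord_vbasis (memvf x)).
by apply: eq_bigr => i _; rewrite ffunE act_scalar.
Qed.

(* Projective resolutions ... -> P_1 -> P_0 -> X -> 0. *)
Record projres (X : fdmod A) := Projres {
  res_mod :> nat -> fdmod A;
  res_aug : 'Hom(res_mod 0, X);
  res_d : forall n, 'Hom(res_mod n.+1, res_mod n);
  res_proj : forall n, mod_projective (res_mod n);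
  res_aug_hom : is_hom res_aug;
  res_d_hom : forall n, is_hom (res_d n);
  res_aug_surj : limg res_aug = fullv;
  res_exact0 : limg (res_d 0) = lker res_aug;
  res_exactS : forall n, limg (res_d n.+1) = lker (res_d n)
}.

(* The resolution by free modules of rank dim X, dim (ker), ... *)
Section FreeResolution.
Variable X : fdmod A.

Fixpoint free_syz (n : nat) : fdmod A :=
  if n is m.+1 then ker_mod (@free_cover_hom (free_syz m)) else X.

Definition free_res_mod n : fdmod A := free_mod (\dim {:free_syz n}).

Definition free_res_d n : 'Hom(free_res_mod n.+1, free_res_mod n) :=
  (ker_incl (@free_cover_hom (free_syz n)) \o free_cover (free_syz n.+1))%VF.

Lemma ker_inclE M N (f : 'Hom(M, N)) (fH : is_hom f) x :
  ker_incl fH x = vsval x.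
Proof. by rewrite lfunE. Qed.

Lemma ker_incl_hom M N (f : 'Hom(M, N)) (fH : is_hom f) : is_hom (ker_incl fH).
Proof.
by move=> a x; rewrite !ker_inclE /= vsprojK // (act_lker fH) // subvsP.
Qed.

Lemma limg_ker_incl M N (f : 'Hom(M, N)) (fH : is_hom f) :
  limg (ker_incl fH) = lker f.
Proof.
apply/vspaceP=> x; apply/memv_imgP/idP => [[y _ ->]|xf].
  by rewrite ker_inclE subvsP.
by exists (vsproj (lker f) x); rewrite ?memvf // ker_inclE vsprojK.
Qed.

Lemma lker_ker_incl M N (f : 'Hom(M, N)) (fH : is_hom f) :
  lker (ker_incl fH) = 0%VS.
Proof. by apply/eqP/lker0P=> x y; rewrite !ker_inclE; apply: val_inj. Qed.

Lemma free_res_d_hom n : is_hom (free_res_d n).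
Proof.
move=> a x; rewrite !comp_lfunE.
by rewrite (@free_cover_hom (free_syz n.+1)) ker_incl_hom.
Qed.

Lemma limg_free_res_d n : limg (free_res_d n) = lker (free_cover (free_syz n)).
Proof. by rewrite limg_comp free_cover_surj limg_ker_incl. Qed.

Lemma lker_free_res_d n :
  lker (free_res_d n) = lker (free_cover (free_syz n.+1)).
Proof.
apply/vspaceP=> x; rewrite !memv_ker comp_lfunE.
apply/eqP/eqP => [/eqP|->]; last exact: linear0.
by rewrite -memv_ker lker_ker_incl memv0 => /eqP.
Qed.

Definition free_res : projres X.
Proof.
refine (@Projres X free_res_mod (free_cover X) free_res_d
  (fun n => @free_mod_projective _) (@free_cover_hom X) free_res_d_hom
  (@free_cover_surj X) _ _).
- exact: (limg_free_res_d 0).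
- by move=> n; rewrite limg_free_res_d lker_free_res_d.
Defined.

End FreeResolution.

(* Hom_A(M, N) cut out of Hom_K(M, N) by the elements of a K-basis of A;
   see [mem_homA]. *)
Section Hom.
Variables M N : fdmod A.

Definition hom_defect (a : A) (f : 'Hom(M, N)) : 'Hom(M, N) :=
  ((f \o linfun (act a)) - (linfun (act a) \o f))%VF.

Fact hom_defect_linear a : linear (hom_defect a).
Proof.
move=> k f g; apply/lfunP=> x; rewrite !lfun_simp /= linearP.
by rewrite scalerBr opprD addrACA.
Qed.

HB.instance Definition _ a :=
  GRing.isLinear.Build K 'Hom(M, N) 'Hom(M, N) _ (hom_defect a)
    (hom_defect_linear a).

Definition homA : {vspace 'Hom(M, N)} :=
  (\bigcap_(i < \dim {:A}) lker (linfun (hom_defect (vbasis {:A})`_i)))%VS.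

Lemma mem_homA (f : 'Hom(M, N)) : f \in homA <-> is_hom f.
Proof.
rewrite memvE; split=> [/subv_bigcapP fH a x|fH].
  rewrite (coord_vbasis (memvf a)).
  apply: (big_rec (fun u => f (act u x) = act u (f x))) => [|i u _ IH].
    by rewrite !act0 linear0.
  rewrite !act_linlP -IH [LHS]linearP; congr (_ *: _ + _).
  have := fH i isT; rewrite -memvE memv_ker lfunE /= => /eqP/lfunP/(_ x).
  by rewrite !lfun_simp /= => /eqP; rewrite subr_eq0 => /eqP.
apply/subv_bigcapP=> i _; rewrite -memvE memv_ker lfunE /=; apply/eqP/lfunP=> x.
by rewrite !lfun_simp /= fH subrr.
Qed.

End Hom.

(* Ext^n_A(X, Y): the n-th cohomology of Hom_A(P_*, Y). *)
Section Ext.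
Variables (X : fdmod A) (P : projres X) (Y : fdmod A).

Definition res_pullback_fun n (f : 'Hom(P n, Y)) : 'Hom(P n.+1, Y) :=
  (f \o res_d P n)%VF.

Fact res_pullback_linear n : linear (@res_pullback_fun n).
Proof.
by move=> k f g; rewrite /res_pullback_fun comp_lfunDl comp_lfunZl.
Qed.

HB.instance Definition _ n :=
  GRing.isLinear.Build K 'Hom(P n, Y) 'Hom(P n.+1, Y) _ (@res_pullback_fun n)
    (@res_pullback_linear n).

Definition res_pullback n : 'Hom('Hom(P n, Y), 'Hom(P n.+1, Y)) :=
  linfun (@res_pullback_fun n).

Lemma res_pullbackE n (f : 'Hom(P n, Y)) :
  res_pullback n f = (f \o res_d P n)%VF.
Proof. by rewrite lfunE. Qed.

Definition cocycles n : {vspace 'Hom(P n, Y)} :=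
  (homA (P n) Y :&: lker (res_pullback n))%VS.

Definition coboundaries n : {vspace 'Hom(P n, Y)} :=
  match n with
  | 0 => 0%VS
  | m.+1 => (res_pullback m @: homA (P m) Y)%VS
  end.

Definition Ext_res n : vectType K :=
  subvs_of (quot_pi (coboundaries n) @: cocycles n)%VS.

Lemma coboundaries_sub n : (coboundaries n <= cocycles n)%VS.
Proof.
case: n => [|n] /=; first exact: sub0v.
apply/subvP=> _ /memv_imgP[f /mem_homA fH ->].
rewrite memv_cap memv_ker !res_pullbackE; apply/andP; split.
  by apply/mem_homA=> a x; rewrite !comp_lfunE res_d_hom fH.
apply/eqP/lfunP=> x; rewrite !comp_lfunE zero_lfunE.
have /eqP-> : res_d P n (res_d P n.+1 x) == 0.
  by rewrite -memv_ker -res_exactS memv_img ?memvf.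
exact: linear0.
Qed.

End Ext.

(* By the comparison theorem the choice of resolution is immaterial up to
   isomorphism. *)
Definition Ext n X Y : vectType K := Ext_res (free_res X) Y n.

End Modules.

(* Finite-dimensional A-A-bimodules, i.e. left modules over the enveloping
   algebra. *)
Record fdbimod (K : fieldType) (A : falgType K) := Fdbimod {
  bi_mod :> fdmod A;
  ract : bi_mod -> A -> bi_mod;
  ract_linl : forall a, linear (ract^~ a);
  ract_linr : forall x, linear (ract x);
  ract1 : forall x, ract x 1 = x;
  ractM : forall x a b, ract x (a * b) = ract (ract x a) b;
  act_ract : forall a b x, act a (ract x b) = ract (act a x) b
}.

Section Bimodules.
Variables (K : fieldType) (A : falgType K).
Implicit Types M N P : fdbimod A.

Definition is_bihom M N (f : M -> N) : Prop :=
  is_hom f /\ forall x a, f (ract x a) = ract (f x) a.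

Definition bimod_iso M N : Prop :=
  exists f : 'Hom(M, N), is_bihom f /\ bijective f.

Definition bimod_projective P : Prop :=
  forall M N (g : 'Hom(M, N)) (f : 'Hom(P, N)),
    is_bihom g -> is_bihom f -> limg g = fullv ->
    exists h : 'Hom(P, M), is_bihom h /\ (g \o h)%VF = f.

(* p is an essential epimorphism from a projective. *)
Definition bimod_projcover P M (p : 'Hom(P, M)) : Prop :=
  [/\ bimod_projective P, is_bihom p, limg p = fullv &
      forall N (h : 'Hom(N, P)),
        is_bihom h -> limg (p \o h)%VF = fullv -> limg h = fullv].

(* N is the kernel of a projective cover of M.  Syzygies are thus defined up to
   isomorphism, hence as a relation. *)
Definition is_syzygy M N : Prop :=
  exists P (p : 'Hom(P, M)) (i : 'Hom(N, P)),
    [/\ bimod_projcover p, is_bihom i, lker i = 0%VS & limg i = lker p].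

(* [is_nsyzygy n M N] : N is an n-th syzygy of M. *)
Fixpoint is_nsyzygy (n : nat) M N : Prop :=
  if n is m.+1 then exists L, is_nsyzygy m M L /\ is_syzygy L N
  else bimod_iso M N.

Definition reg_bimod : fdbimod A.
Proof.
refine (@Fdbimod K A (reg_mod A) (fun x a => x * a) _ _ _ _ _).
- by move=> a k x y; rewrite mulrDl -scalerAl.
- by move=> x k a b; rewrite mulrDr -scalerAr.
- exact: mulr1.
- by move=> x a b; rewrite mulrA.
- by move=> a b x; apply: mulrA.
Defined.

Definition twist_bimod (phi : algaut A) M : fdbimod A.
Proof.
refine (@Fdbimod K A (twist_mod phi M) (@ract K A M) _ _ _ _ _).
- exact: ract_linl.
- exact: ract_linr.
- exact: ract1.
- exact: ractM.
- by move=> a b x; apply: act_ract.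
Defined.

Definition ract_fun M (a : A) (x : M) : M := ract x a.

HB.instance Definition _ M a :=
  GRing.isLinear.Build K M M _ (@ract_fun M a) (@ract_linl K A M a).

(* D(M) with (a f b)(x) = f (b x a). *)
Definition dual_mod M : fdmod A.
Proof.
refine (@Fdmod K A (vdual M)
  (fun a f => (f \o linfun (@ract_fun M a))%VF) _ _ _ _).
- move=> f k a b; apply/lfunP=> x; rewrite !lfun_simp /= /ract_fun.
  by rewrite ract_linr linearP.
- by move=> a k f g; rewrite comp_lfunDl comp_lfunZl.
- by move=> f; apply/lfunP=> x; rewrite !lfun_simp /= /ract_fun ract1.
- by move=> a b f; apply/lfunP=> x; rewrite !lfun_simp /= /ract_fun ractM.
Defined.

Definition dual_bimod M : fdbimod A.
Proof.
refine (@Fdbimod K A (dual_mod M)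
  (fun f b => ((f : 'Hom(M, K^o)) \o linfun (@act K A M b))%VF) _ _ _ _ _).
- by move=> b k f g; rewrite comp_lfunDl comp_lfunZl.
- move=> f k a b; apply/lfunP=> x; rewrite !lfun_simp /=.
  by rewrite act_linlP linearP.
- by move=> f; apply/lfunP=> x; rewrite !lfun_simp /= act1.
- by move=> f a b; apply/lfunP=> x; rewrite !lfun_simp /= actM.
- by move=> a b f; apply/lfunP=> x; rewrite !lfun_simp /= act_ract.
Defined.

Definition self_injective : Prop := mod_injective (reg_mod A).

Definition nakayama_aut (eta : algaut A) : Prop :=
  bimod_iso (dual_bimod reg_bimod) (twist_bimod (aut_inv eta) reg_bimod).

Definition equivariant (gamma : algaut A) (Y : fdmod A) : Prop :=
  mod_iso (twist_mod gamma Y) Y.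

End Bimodules.

Arguments self_injective {K} A.
Arguments reg_bimod {K} A.

(* Main.v *)
Require Import Defs.
From HB Require Import structures.
From mathcomp Require Import all_boot all_order all_algebra all_field.
From mathcomp Require Import zify.

Set Implicit Arguments.
Unset Strict Implicit.
Unset Printing Implicit Defensive.

Import GRing.Theory VectorInternalTheory.
Local Open Scope ring_scope.

(** It suffices to compare dimensions; write nu for the twist by eta^-1 and
    Z = _mu Y, so that nu Z = Y by equivariance.  The bimodule projective covers
    P_i of the syzygies of A split as sequences of left modules, hence applying
    Hom_A(-, Z) gives an exact sequence
    [0 -> Z -> J_0 -> J_1 -> J_2 -> Y -> 0], the last term being
    Hom_A(_mu A, Z) = Y.  Each J_i = Hom_A(P_i, Z) is injective, and therefore a
    retract of a free module, A being Frobenius.  For such J the Frobenius form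
    pairs Hom(X, nu J) and Hom(J, X) perfectly and naturally in J, which yields
    the Auslander-Reiten formula
    [hom(X, nu V) + hom(J', X) = hom(J, X) + hom(V', X)]
    for exact [0 -> V -> J -> J' -> V' -> 0].  Computing Ext^1(X, Y) from
    [0 -> nu Z -> nu J_0 -> nu V_1 -> 0] and Ext^1(Y, X) from
    [0 -> V_2 -> J_2 -> Y -> 0], where V_i is the i-th cosyzygy of Z, the formula
    for J_0 -> J_1 and J_1 -> J_2 gives the equality. *)

(** * Linear algebra: composition operators and the dimension bound given by a bilinear pairing *)

Section LinearAlgebra.
Variable K : fieldType.

Fact lfun_of_subproof (V W : vectType K) (f : V -> W) :
  linear f -> {F : 'Hom(V, W) | F =1 f}.
Proof.
move=> fL; pose fM := HB.pack_for {linear V -> W} f (GRing.isLinear.Build K V W _ f fL).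
by exists (linfun fM) => x; rewrite lfunE.
Qed.

(** Takes linearity as an explicit proof, which suits maps defined in the middle of an argument. *)
Definition lfun_of (V W : vectType K) (f : V -> W) (fL : linear f) : 'Hom(V, W) :=
  sval (lfun_of_subproof fL).

Lemma lfun_ofE (V W : vectType K) (f : V -> W) (fL : linear f) : lfun_of fL =1 f.
Proof. exact: (svalP (lfun_of_subproof fL)). Qed.

Lemma viso_dim (V W : vectType K) : \dim {:V} = \dim {:W} -> viso V W.
Proof.
rewrite !dimvf => dVW.
pose f (v : V) : W := r2v (castmx (erefl, dVW) (v2r v)).
have castL m n (e : m = n) : linear (castmx (erefl, e) : 'rV[K]_m -> 'rV[K]_n).
  by case: n / e => k u v; rewrite !castmx_id.
have fL : linear f by move=> k u v; rewrite /f linearP castL linearP.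
exists (lfun_of fL); exists (fun w => r2v (castmx (erefl, esym dVW) (v2r w))) => v.
  by rewrite lfun_ofE /f r2vK castmx_comp castmx_id v2rK.
by rewrite lfun_ofE /f r2vK castmx_comp castmx_id v2rK.
Qed.

Lemma bij_lker0 (V W : vectType K) (f : 'Hom(V, W)) : bijective f -> lker f = 0%VS.
Proof. by move=> /bij_inj fI; apply/eqP/lker0P. Qed.

Lemma bij_limg (V W : vectType K) (f : 'Hom(V, W)) : bijective f -> limg f = fullv.
Proof.
case=> g _ gK; apply/eqP; rewrite eqEsubv subvf; apply/subvP=> w _.
by rewrite -(gK w) memv_img ?memvf.
Qed.

Lemma lfun_surjK (V W : vectType K) (f : 'Hom(V, W)) :
  limg f = fullv -> cancel f^-1%VF f.
Proof. by move=> fS w; rewrite limg_lfunVK // fS memvf. Qed.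

Fact coord_fun_linear (V : vectType K) k :
  linear (coord (vbasis {:V}) k : V -> K^o).
Proof. by move=> c x y; rewrite linearP. Qed.

Definition coord_form (V : vectType K) k : 'Hom(V, K^o) :=
  lfun_of (@coord_fun_linear V k).

Section Composition.
Variables U V : vectType K.

Definition precomp_fun (W : vectType K) (f : 'Hom(U, V)) (g : 'Hom(V, W)) :=
  (g \o f)%VF.

Fact precomp_linear (W : vectType K) f : linear (@precomp_fun W f).
Proof. by move=> k g h; rewrite /precomp_fun comp_lfunDl comp_lfunZl. Qed.

HB.instance Definition _ (W : vectType K) f :=
  GRing.isLinear.Build K 'Hom(V, W) 'Hom(U, W) _ (@precomp_fun W f)
    (@precomp_linear W f).

Definition precomp (W : vectType K) f : 'Hom('Hom(V, W), 'Hom(U, W)) :=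
  linfun (@precomp_fun W f).

Lemma precompE (W : vectType K) f (g : 'Hom(V, W)) : precomp W f g = (g \o f)%VF.
Proof. by rewrite lfunE. Qed.

Definition postcomp_fun (W : vectType K) (f : 'Hom(U, V)) (g : 'Hom(W, U)) :=
  (f \o g)%VF.

Fact postcomp_linear (W : vectType K) f : linear (@postcomp_fun W f).
Proof. by move=> k g h; rewrite /postcomp_fun comp_lfunDr comp_lfunZr. Qed.

HB.instance Definition _ (W : vectType K) f :=
  GRing.isLinear.Build K 'Hom(W, U) 'Hom(W, V) _ (@postcomp_fun W f)
    (@postcomp_linear W f).

Definition postcomp (W : vectType K) f : 'Hom('Hom(W, U), 'Hom(W, V)) :=
  linfun (@postcomp_fun W f).

Lemma postcompE (W : vectType K) f (g : 'Hom(W, U)) : postcomp W f g = (f \o g)%VF.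
Proof. by rewrite lfunE. Qed.

Lemma precomp_inj (W : vectType K) f : limg f = fullv -> lker (precomp W f) = 0%VS.
Proof.
move=> fS; apply/eqP/lker0P=> g h; rewrite !precompE => gh.
by apply/lfunP=> v; rewrite -(lfun_surjK fS v) -!comp_lfunE gh.
Qed.

Lemma postcomp_inj (W : vectType K) f : lker f = 0%VS -> lker (postcomp W f) = 0%VS.
Proof.
move=> /eqP/lker0P fI; apply/eqP/lker0P=> g h; rewrite !postcompE => gh.
by apply/lfunP=> v; apply: fI; rewrite -!comp_lfunE gh.
Qed.

End Composition.

Lemma dim_img_inj (V W : vectType K) (f : 'Hom(V, W)) (S : {vspace V}) :
  lker f = 0%VS -> \dim (f @: S) = \dim S.
Proof. by move=> f0; rewrite limg_dim_eq // f0 capv0. Qed.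

(** Rank-nullity for the map sending [w] to its values on a basis of [U]: its kernel in [W] lies in
    [S]. With [S = 0] this bounds one side of a nondegenerate pairing; with [S] containing the
    annihilator of [U] it compares ranks of adjoint maps. *)
Lemma pairing_dim (V1 V2 : vectType K) (B : V1 -> V2 -> K^o)
    (W S : {vspace V1}) (U : {vspace V2}) :
  (forall w, linear (B w)) -> (forall u, linear (B^~ u)) ->
  (forall w, w \in W -> (forall u, u \in U -> B w u = 0) -> w \in S) ->
  (\dim W <= \dim U + \dim S)%N.
Proof.
move=> Br Bl WS.
pose t w : 'rV[K]_(\dim U) := \row_i B w (vbasis U)`_i.
have tL : linear t by move=> k u v; apply/rowP=> i; rewrite !mxE Bl.
pose T := lfun_of tL.
rewrite -(limg_ker_dim T W) addnC leq_add //.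
  by apply: leq_trans (dimvS (subvf _)) _; rewrite dimvf /dim /= mul1n.
apply/dimvS/subvP=> w; rewrite memv_cap memv_ker lfun_ofE => /andP[wW /eqP/rowP tw].
apply: WS => // u /coord_vbasis ->.
rewrite -(lfun_ofE (Br w)) linear_sum big1 // => i _; rewrite linearZ /= lfun_ofE.
by have := tw i; rewrite !mxE => ->; rewrite scaler0.
Qed.

End LinearAlgebra.

(** * Dimensions of Hom spaces along short exact sequences, and of Ext^1 *)

Section HomDimensions.
Variables (K : fieldType) (A : falgType K).
Implicit Types M N P U V X Y I C J : fdmod A.

Lemma is_hom_comp M N P (f : 'Hom(M, N)) (g : 'Hom(N, P)) :
  is_hom f -> is_hom g -> is_hom (g \o f)%VF.
Proof. by move=> fH gH a x; rewrite !comp_lfunE fH gH. Qed.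

Lemma is_hom_sub M N (f g : 'Hom(M, N)) : is_hom f -> is_hom g -> is_hom (f - g)%VF.
Proof. by move=> fH gH a x; rewrite !lfun_simp /= fH gH linearB. Qed.

Lemma is_hom_id M : is_hom (\1 : 'Hom(M, M))%VF.
Proof. by move=> a x; rewrite !id_lfunE. Qed.

(** The factor [j^-1 \o f] is built over K only; injectivity of [j] then forces it to commute with
    the action. *)
Lemma is_hom_factor_inj M N P (j : 'Hom(N, P)) (f : 'Hom(M, P)) :
  is_hom j -> is_hom f -> lker j = 0%VS -> (limg f <= limg j)%VS ->
  exists g : 'Hom(M, N), is_hom g /\ (j \o g)%VF = f.
Proof.
move=> jH fH /eqP/lker0P j0 /subvP fj.
have jK x : j (j^-1%VF (f x)) = f x by rewrite limg_lfunVK ?fj ?memv_img ?memvf.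
exists (j^-1 \o f)%VF; split=> [a x|]; last by apply/lfunP=> x; rewrite !comp_lfunE.
by apply: j0; rewrite jH !comp_lfunE !jK fH.
Qed.

Lemma is_hom_factor_surj M N P (p : 'Hom(M, N)) (f : 'Hom(M, P)) :
  is_hom p -> is_hom f -> limg p = fullv -> (lker p <= lker f)%VS ->
  exists g : 'Hom(N, P), is_hom g /\ (g \o p)%VF = f.
Proof.
move=> pH fH pS /subvP pf.
have fK x : f (p^-1%VF (p x)) = f x.
  apply/eqP; rewrite -subr_eq0 -linearB -memv_ker pf // memv_ker linearB /=.
  by rewrite lfun_surjK // subrr.
exists (f \o p^-1)%VF; split=> [a x|]; last by apply/lfunP=> x; rewrite !comp_lfunE.
by rewrite -(lfun_surjK pS x) -pH !comp_lfunE !fK fH.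
Qed.

Lemma mod_iso_sym M N : mod_iso M N -> mod_iso N M.
Proof.
case=> f [fH fB]; have f0 := bij_lker0 fB; have fS := bij_limg fB.
have [||||g [gH fg]] := @is_hom_factor_inj N M N f \1%VF => //.
  exact: is_hom_id.
  by rewrite fS subvf.
have gK : cancel g f by move=> x; rewrite -comp_lfunE fg id_lfunE.
exists g; split=> //; exists f => // x.
by apply: (bij_inj fB); rewrite gK.
Qed.

Lemma hom_dim_iso X M N : mod_iso M N -> \dim (homA X M) = \dim (homA X N).
Proof.
suff le M' N' : mod_iso M' N' -> (\dim (homA X M') <= \dim (homA X N'))%N.
  by move=> MN; apply/eqP; rewrite eqn_leq !le //; apply: mod_iso_sym.
case=> f [fH /bij_lker0 f0].
rewrite -(dim_img_inj _ (postcomp_inj X f0)); apply/dimvS/subvP.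
by move=> _ /memv_imgP[g /mem_homA gH ->]; rewrite postcompE; apply/mem_homA/is_hom_comp.
Qed.

Definition short_exact U P X (i : 'Hom(U, P)) (p : 'Hom(P, X)) : Prop :=
  [/\ is_hom i, is_hom p, lker i = 0%VS, limg i = lker p & limg p = fullv].

Lemma comp_lfun_eq0 (V1 V2 V3 : vectType K) (f : 'Hom(V1, V2)) (g : 'Hom(V2, V3)) :
  ((g \o f)%VF == 0) = (limg f <= lker g)%VS.
Proof.
apply/eqP/subvP=> [gf _ /memv_imgP[x _ ->]|fg].
  by rewrite memv_ker -comp_lfunE gf zero_lfunE.
apply/lfunP=> x; rewrite comp_lfunE zero_lfunE; apply/eqP.
by rewrite -memv_ker fg ?memv_img ?memvf.
Qed.

Lemma homA_precomp (W : vectType K) P X Y (f : 'Hom(W, P)) (p : 'Hom(P, X)) :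
  is_hom p -> limg p = fullv -> limg f = lker p ->
  (precomp Y p @: homA X Y = homA P Y :&: lker (precomp Y f))%VS.
Proof.
move=> pH pS fp; apply/vspaceP=> g; rewrite memv_cap memv_ker precompE comp_lfun_eq0 fp.
apply/memv_imgP/andP=> [[h /mem_homA hH ->]|[/mem_homA gH pg]].
  rewrite precompE; split; first by apply/mem_homA/is_hom_comp.
  by apply/subvP=> x; rewrite !memv_ker comp_lfunE => /eqP->; rewrite linear0.
have [h [hH hp]] := is_hom_factor_surj pH gH pS pg.
by exists h; [apply/mem_homA|rewrite precompE].
Qed.

Lemma homA_postcomp (W : vectType K) U Y I (j : 'Hom(Y, I)) (f : 'Hom(I, W)) :
  is_hom j -> lker j = 0%VS -> limg j = lker f ->
  (postcomp U j @: homA U Y = homA U I :&: lker (postcomp U f))%VS.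
Proof.
move=> jH j0 jf; apply/vspaceP=> g.
rewrite memv_cap memv_ker postcompE comp_lfun_eq0 -jf.
apply/memv_imgP/andP=> [[h /mem_homA hH ->]|[/mem_homA gH gj]].
  rewrite postcompE; split; first by apply/mem_homA/is_hom_comp.
  by apply/subvP=> _ /memv_imgP[x _ ->]; rewrite comp_lfunE memv_img ?memvf.
have [h [hH jh]] := is_hom_factor_inj jH gH j0 gj.
by exists h; [apply/mem_homA|rewrite postcompE].
Qed.

Lemma dim_precomp P X Y (p : 'Hom(P, X)) :
  limg p = fullv -> \dim (precomp Y p @: homA X Y) = \dim (homA X Y).
Proof. by move=> pS; rewrite dim_img_inj ?precomp_inj. Qed.

Lemma dim_postcomp U Y I (j : 'Hom(Y, I)) :
  lker j = 0%VS -> \dim (postcomp U j @: homA U Y) = \dim (homA U Y).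
Proof. by move=> j0; rewrite dim_img_inj ?postcomp_inj. Qed.

Lemma dim_ker_precomp U P X Y (i : 'Hom(U, P)) (p : 'Hom(P, X)) :
  is_hom p -> limg p = fullv -> limg i = lker p ->
  (\dim (homA X Y) + \dim (precomp Y i @: homA P Y) = \dim (homA P Y))%N.
Proof.
by move=> pH pS ip; rewrite -(dim_precomp Y pS) (homA_precomp Y pH pS ip) limg_ker_dim.
Qed.

(* Both sides are the dimension of the space of homs P -> I carrying U into Y:
   such a map is determined modulo Hom(X, I) by its restriction U -> Y, and modulo
   Hom(P, Y) by the induced map X -> C. *)
Lemma proj_inj_dim U P X Y I C (i : 'Hom(U, P)) (p : 'Hom(P, X))
    (j : 'Hom(Y, I)) (c : 'Hom(I, C)) :
  short_exact i p -> short_exact j c -> mod_projective P -> mod_injective I ->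
  (\dim (homA U Y) + \dim (homA X I) = \dim (homA X C) + \dim (homA P Y))%N.
Proof.
case=> iH pH i0 ip pS [jH cH j0 jc cS] Pp Ii.
have /eqP cj : (c \o j == 0)%VF by rewrite comp_lfun_eq0 jc.
have /eqP pi : (p \o i == 0)%VF by rewrite comp_lfun_eq0 ip.
pose W := (homA P I :&: lker (precomp C i \o postcomp P c))%VS.
have WP g : g \in W <-> is_hom g /\ ((c \o g) \o i)%VF = 0.
  rewrite memv_cap memv_ker comp_lfunE precompE postcompE.
  by split=> [/andP[/mem_homA gH /eqP]|[/mem_homA-> ->]]; rewrite ?eqxx.
transitivity (\dim W).
  rewrite -(limg_ker_dim (precomp I i) W) addnC; congr (_ + _)%N.
    rewrite -(dim_precomp I pS) (homA_precomp I pH pS ip); congr (\dim _).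
    apply/vspaceP=> g; rewrite !memv_cap !memv_ker comp_lfunE !precompE postcompE.
    case: (g \in _) => //=; case: ((g \o i)%VF =P 0) => [gi|]; rewrite ?andbF //= andbT.
    by rewrite -comp_lfunA gi comp_lfun0r eqxx.
  rewrite -(dim_postcomp U j0); congr (\dim _); apply/vspaceP=> g.
  apply/memv_imgP/memv_imgP=> [[h /mem_homA hH ->]|[h /WP[hH chi] ->]].
    have jhH := is_hom_comp hH jH.
    have [k [kH ki]] := Ii _ _ i _ iH jhH i0.
    exists k; last by rewrite precompE postcompE.
    apply/WP; split=> //; rewrite -comp_lfunA ki comp_lfunA.
    by rewrite cj comp_lfun0l.
  have hiH := is_hom_comp iH hH.
  have [|k [kH jk]] := is_hom_factor_inj jH hiH j0.
    by rewrite jc -comp_lfun_eq0 comp_lfunA chi.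
  by exists k; [apply/mem_homA|rewrite postcompE precompE].
rewrite -(limg_ker_dim (postcomp P c) W) addnC; congr (_ + _)%N; last first.
  rewrite -(dim_postcomp P j0) (homA_postcomp P jH j0 jc); congr (\dim _).
  apply/vspaceP=> g; rewrite !memv_cap !memv_ker comp_lfunE !precompE postcompE.
  case: (g \in _) => //=; case: ((c \o g)%VF =P 0) => [cg|]; rewrite ?andbF //= andbT.
  by rewrite cg comp_lfun0l eqxx.
rewrite -(dim_precomp C pS); congr (\dim _); apply/vspaceP=> g.
apply/memv_imgP/memv_imgP=> [[h /WP[hH chi] ->]|[h /mem_homA hH ->]].
  have chH := is_hom_comp hH cH.
  have [|k [kH kp]] := is_hom_factor_surj pH chH pS.
    by rewrite -ip -comp_lfun_eq0 chi.
  by exists k; [apply/mem_homA|rewrite postcompE precompE].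
have hpH := is_hom_comp pH hH.
have [k [kH ck]] := Pp _ _ c _ cH hpH cS.
exists k; last by rewrite precompE postcompE.
apply/WP; split=> //; rewrite ck -comp_lfunA.
by rewrite pi comp_lfun0r.
Qed.

(** Numerical Schanuel lemma. Let B and B' be the homs to X from U and U' that extend to P and P'.
    Comparison maps [h], [h'] over Y induce [k : U' -> U], and precomposition with [k] embeds Hom(U,
    X)/B into Hom(U', X)/B'; both quotients compute Ext^1(Y, X). *)
Lemma schanuel_dim_le U P U' P' Y X (i : 'Hom(U, P)) (p : 'Hom(P, Y))
    (i' : 'Hom(U', P')) (p' : 'Hom(P', Y)) :
  short_exact i p -> short_exact i' p' -> mod_projective P -> mod_projective P' ->
  (\dim (homA U X) + \dim (homA P' X) <= \dim (homA U' X) + \dim (homA P X))%N.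
Proof.
case=> iH pH i0 ip pS [iH' pH' i0' ip' pS'] Pp Pp'.
have [h [hH hp]] := Pp _ _ p' p pH' pH pS'.
have [h' [hH' hp']] := Pp' _ _ p p' pH pH' pS.
have [||k [kH ik]] := @is_hom_factor_inj U' U P i (h' \o i')%VF iH _ i0.
- exact: is_hom_comp.
- by rewrite ip -comp_lfun_eq0 comp_lfunA hp' comp_lfun_eq0 ip'.
have idH := @is_hom_id P.
have [||r [rH ir]] := @is_hom_factor_inj P U P i (\1 - (h' \o h))%VF iH _ i0.
- by apply: is_hom_sub => //; apply: is_hom_comp.
- rewrite ip -comp_lfun_eq0 comp_lfunDr comp_lfunNr comp_lfun1r comp_lfunA hp' hp.
  by rewrite subrr.
pose B := (precomp X i @: homA P X)%VS; pose B' := (precomp X i' @: homA P' X)%VS.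
have dB := dim_ker_precomp X pH pS ip; have dB' := dim_ker_precomp X pH' pS' ip'.
suff le : (\dim (homA U X) + \dim B' <= \dim (homA U' X) + \dim B)%N.
  by rewrite -dB -dB' addnCA [X in (_ <= X)%N]addnCA leq_add2l.
have B'S : (B' <= homA U' X)%VS.
  apply/subvP=> _ /memv_imgP[g /mem_homA gH ->]; rewrite precompE.
  exact/mem_homA/is_hom_comp.
have [_ kerq] := quot_piP B'.
(* Rank-nullity for [T] on Hom(U, X): its kernel will be shown to lie in [B], its image in that of
   Hom(U', X). *)
pose T := (quot_pi B' \o precomp X k)%VF.
rewrite -(limg_ker_dim (quot_pi B') (homA U' X)) kerq (capv_idPr B'S).
rewrite -(limg_ker_dim T (homA U X)) addnAC [X in (_ <= X)%N]addnC addnA leq_add //.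
  rewrite leq_add2r; apply/dimvS/subvP=> u; rewrite memv_cap memv_ker comp_lfunE.
  case/andP=> /mem_homA uH; rewrite -memv_ker kerq precompE.
  case/memv_imgP=> f' /mem_homA fH'; rewrite precompE => uk.
  (* Given [u k = f' i'], this map extends [u] to P: on U one has [r i = 1 - k h], with [h]
     restricted to U -> U', and [f' h = u k h] there. *)
  apply/memv_imgP; exists ((u \o r) + (f' \o h))%VF.
    apply/mem_homA=> a x; rewrite !lfun_simp /= rH uH hH fH'.
    by rewrite linearD.
  have ri x : i x - h' (h (i x)) = i (r (i x)).
    by rewrite -[RHS]comp_lfunE ir !lfun_simp.
  rewrite precompE; apply/lfunP=> x; rewrite !lfun_simp /=.
  have /memv_imgP[y _ hy] : h (i x) \in limg i'.
    rewrite ip' memv_ker -comp_lfunE hp -memv_ker -ip memv_img //; exact: memvf.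
  rewrite hy -[f' _]comp_lfunE -uk comp_lfunE -linearD; congr (u _).
  move/eqP/lker0P: i0; apply; rewrite linearD /= -ri hy.
  by rewrite -[i (k y)]comp_lfunE ik comp_lfunE subrK.
rewrite limg_comp; apply/dimvS/limgS/subvP=> _ /memv_imgP[u /mem_homA uH ->].
by rewrite precompE; apply/mem_homA/is_hom_comp.
Qed.

Lemma schanuel_dim U P U' P' Y X (i : 'Hom(U, P)) (p : 'Hom(P, Y))
    (i' : 'Hom(U', P')) (p' : 'Hom(P', Y)) :
  short_exact i p -> short_exact i' p' -> mod_projective P -> mod_projective P' ->
  (\dim (homA U X) + \dim (homA P' X) = \dim (homA U' X) + \dim (homA P X))%N.
Proof.
move=> ses ses' Pp Pp'; apply/eqP; rewrite eqn_leq.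
by rewrite (schanuel_dim_le X ses ses') // (schanuel_dim_le X ses' ses).
Qed.

Lemma free_syz_exact X :
  short_exact (ker_incl (@free_cover_hom K A X)) (free_cover X).
Proof.
split; [exact: ker_incl_hom | exact: free_cover_hom | exact: lker_ker_incl | |].
  exact: limg_ker_incl.
exact: free_cover_surj.
Qed.

Lemma dim_quot_img (V : vectType K) (B Z : {vspace V}) :
  (B <= Z)%VS -> (\dim B + \dim (quot_pi B @: Z) = \dim Z)%N.
Proof.
have [_ kerq] := quot_piP B => /capv_idPr BZ.
by rewrite -(limg_ker_dim (quot_pi B) Z) kerq BZ.
Qed.

(** Euler characteristic of 0 -> Hom(X, Y) -> Hom(P_0, Y) -> Hom(Omega X, Y) -> Ext^1(X, Y) -> 0,
    written without subtraction. *)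
Lemma Ext1_dim X Y :
  (\dim {: Ext 1 X Y} + \dim (homA (free_res X 0) Y)
    = \dim (homA (free_syz X 1) Y) + \dim (homA X Y))%N.
Proof.
pose F := free_res X.
have pb n : res_pullback F Y n = precomp Y (res_d F n).
  by apply/lfunP=> f; rewrite [LHS]res_pullbackE [RHS]precompE.
have cH := @free_cover_hom _ _ (free_syz X 1).
have cS := @free_cover_surj _ _ (free_syz X 1).
(* A 1-cocycle vanishes on the image of P_2, hence factors uniquely through the cover of Omega X by
   P_1. *)
have dZ : \dim (cocycles F Y 1) = \dim (homA (free_syz X 1) Y).
  by rewrite /cocycles pb -(homA_precomp Y cH cS (limg_free_res_d X 1)) dim_precomp.
have dB := dim_ker_precomp Y (@free_cover_hom _ _ X) (@free_cover_surj _ _ X)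
  (limg_free_res_d X 0).
have dE : (\dim (coboundaries F Y 1) + \dim {: Ext 1 X Y}
    = \dim (cocycles F Y 1))%N.
  by rewrite -(dim_quot_img (@coboundaries_sub _ _ _ F Y 1)) dimvf.
by rewrite -dZ -dE -dB /= pb addnCA [RHS]addnC; congr (_ + _)%N; rewrite addnC.
Qed.

End HomDimensions.

(** * Twisting modules by an automorphism *)

Section Twist.
Variables (K : fieldType) (A : falgType K) (phi : algaut A).
Implicit Types M N U P X J : fdmod A.

Lemma twist_hom M N (f : 'Hom(M, N)) :
  is_hom f -> @is_hom K A (twist_mod phi M) (twist_mod phi N) f.
Proof. by move=> fH a; apply: fH. Qed.

Lemma twist_exact U P X (i : 'Hom(U, P)) (p : 'Hom(P, X)) :
  short_exact i p ->
  @short_exact K A (twist_mod phi U) (twist_mod phi P) (twist_mod phi X) i p.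
Proof. by case=> iH pH *; split=> //; apply: twist_hom. Qed.

End Twist.

Section TwistInjective.
Variables (K : fieldType) (A : falgType K) (phi : algaut A).
Implicit Types M N J : fdmod A.

(** Twisting the whole extension problem by the inverse automorphism turns it into one for [J]. *)
Lemma twist_injective J : mod_injective J -> mod_injective (twist_mod phi J).
Proof.
move=> Ji M N i f iH fH i0; pose psi := aut_inv phi.
have fH' : @is_hom K A (twist_mod psi M) J f.
  move=> a x; rewrite -[RHS]/(@act K A J a (f x)).
  by rewrite -{2}[a](aut_funK phi) -[RHS]fH.
have iH' := twist_hom (phi := psi) iH.
have [h [hH hi]] := Ji (twist_mod psi M) (twist_mod psi N) i f iH' fH' i0.
exists h; split=> // a x.
rewrite -[RHS]/(@act K A J (aut_invfun phi a) (h x)) -hH.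
by rewrite -[RHS]/(h (@act K A N (phi (aut_invfun phi a)) x)) aut_invfunK.
Qed.

Lemma twist_iso M N : mod_iso M N -> mod_iso (twist_mod phi M) (twist_mod phi N).
Proof. by case=> f [fH fB]; exists f; split=> //; apply: twist_hom. Qed.

End TwistInjective.

(** * The functor Hom_A(-, Z) from bimodules to left modules, applied to syzygies *)

Section HomModule.
Variables (K : fieldType) (A : falgType K).
Implicit Types (L M N P : fdbimod A) (Z : fdmod A).

Lemma homA_ract M Z a (u : subvs_of (homA M Z)) :
  (vsval u \o linfun (@ract_fun K A M a))%VF \in homA M Z.
Proof.
apply/mem_homA=> b x; rewrite !comp_lfunE !lfunE /= /ract_fun -act_ract.
exact: ((mem_homA (vsval u)).1 (subvsP u)).
Qed.

(* Hom_A(M, Z), made a left module by the right action on M. *)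
Definition homA_mod M Z : fdmod A.
Proof.
refine (@Fdmod K A (subvs_of (homA M Z))
  (fun a u => vsproj _ (vsval u \o linfun (@ract_fun K A M a))%VF) _ _ _ _).
- move=> u k a b; rewrite -linearP; congr vsproj; apply/lfunP=> x.
  by rewrite !lfun_simp /= /ract_fun ract_linr linearP.
- move=> a k u v; rewrite -linearP; congr vsproj.
  by rewrite linearP /= comp_lfunDl comp_lfunZl.
- move=> u; rewrite -[RHS]vsvalK; congr vsproj; apply/lfunP=> x.
  by rewrite comp_lfunE lfunE /= /ract_fun ract1.
- move=> a b u; congr vsproj; apply/lfunP=> x.
  rewrite vsprojK; first by rewrite !lfun_simp /= /ract_fun ractM.
  exact: homA_ract.
Defined.

Definition homA_val M Z (u : homA_mod M Z) : 'Hom(M, Z) :=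
  vsval (u : subvs_of (homA M Z)).

(** Total on K-linear maps: a map that is not A-linear is projected to one that is, so [homA_ModK]
    asks for [is_hom]. *)
Definition homA_Mod M Z (f : 'Hom(M, Z)) : homA_mod M Z := vsproj (homA M Z) f.

Lemma homA_val_linear M Z : linear (@homA_val M Z).
Proof. exact: linearP. Qed.

Lemma homA_Mod_linear M Z : linear (@homA_Mod M Z).
Proof. exact: linearP. Qed.

HB.instance Definition _ M Z :=
  GRing.isLinear.Build K (homA_mod M Z) 'Hom(M, Z) _ (@homA_val M Z)
    (@homA_val_linear M Z).

HB.instance Definition _ M Z :=
  GRing.isLinear.Build K 'Hom(M, Z) (homA_mod M Z) _ (@homA_Mod M Z)
    (@homA_Mod_linear M Z).

Lemma homA_ModK M Z (f : 'Hom(M, Z)) : is_hom f -> homA_val (homA_Mod f) = f.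
Proof. by move=> fH; apply: vsprojK; apply/mem_homA. Qed.

Lemma homA_valP M Z (u : homA_mod M Z) : is_hom (homA_val u).
Proof. exact/mem_homA/(@subvsP _ _ (homA M Z)). Qed.

Lemma homA_mod_ext M Z (u v : homA_mod M Z) : homA_val u =1 homA_val v -> u = v.
Proof. by move=> uv; apply: (@subvs_inj _ _ (homA M Z)); apply/lfunP. Qed.

Lemma homA_actE M Z (u : homA_mod M Z) a x :
  homA_val (act a u) x = homA_val u (ract x a).
Proof.
rewrite /homA_val vsprojK; first by rewrite comp_lfunE lfunE.
exact: homA_ract.
Qed.

Definition homA_pull M N Z (p : 'Hom(M, N)) : 'Hom(homA_mod N Z, homA_mod M Z) :=
  (linfun (@homA_Mod M Z) \o precomp Z p \o linfun (@homA_val N Z))%VF.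

Lemma homA_pullE M N Z (p : 'Hom(M, N)) (u : homA_mod N Z) :
  is_hom p -> homA_val (homA_pull Z p u) = (homA_val u \o p)%VF.
Proof.
move=> pH; rewrite !comp_lfunE !lfunE /= homA_ModK //.
by apply: is_hom_comp => //; apply: homA_valP.
Qed.

Lemma homA_pull_hom M N Z (p : 'Hom(M, N)) : is_bihom p -> is_hom (homA_pull Z p).
Proof.
case=> pH pR a u; apply: homA_mod_ext => x.
by rewrite homA_actE !homA_pullE // !comp_lfunE homA_actE pR.
Qed.

(** Exactness on the left is formal. Surjectivity of restriction along [i] comes from the retraction
    [r]: a hom [u] on L extends as [u \o r], and for this [r] need only be left linear. *)
Lemma homA_pull_exact L P M Z (i : 'Hom(L, P)) (p : 'Hom(P, M)) (r : 'Hom(P, L)) :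
  is_bihom i -> is_bihom p -> short_exact i p -> is_hom r -> (r \o i = \1)%VF ->
  short_exact (homA_pull Z p) (homA_pull Z i).
Proof.
move=> iB pB [iH pH i0 ip pS] rH ri; split; try exact: homA_pull_hom.
- apply/eqP/lker0P=> u v /(congr1 (@homA_val _ _)); rewrite !homA_pullE // => uv.
  by apply: homA_mod_ext => x; rewrite -(lfun_surjK pS x) -!comp_lfunE uv.
- apply/vspaceP=> u; rewrite memv_ker; apply/memv_imgP/eqP=> [[v _ ->]|ui].
    apply: homA_mod_ext => x; rewrite !homA_pullE // -comp_lfunA linear0.
    suff /eqP-> : (p \o i == 0)%VF by rewrite comp_lfun0r.
    by rewrite comp_lfun_eq0 ip.
  have uH := homA_valP u.
  have [|v [vH vp]] := is_hom_factor_surj pH uH pS.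
    by rewrite -ip -comp_lfun_eq0 -homA_pullE // ui linear0.
  exists (homA_Mod v); rewrite ?memvf //; apply: homA_mod_ext => x.
  by rewrite homA_pullE // homA_ModK // vp.
apply/eqP; rewrite eqEsubv subvf; apply/subvP=> u _; apply/memv_imgP.
exists (homA_Mod (homA_val u \o r)%VF); rewrite ?memvf //; apply: homA_mod_ext => x.
rewrite homA_pullE // homA_ModK -?comp_lfunA ?ri ?comp_lfun1r //.
by apply: is_hom_comp => //; apply: homA_valP.
Qed.

Definition khom_mod (M Z : fdmod A) : fdmod A.
Proof.
refine (@Fdmod K A 'Hom(M, Z) (fun a f => (linfun (act a) \o f)%VF) _ _ _ _).
- by move=> f k a b; apply/lfunP=> x; rewrite !lfun_simp /= act_linlP.
- by move=> a k f g; rewrite comp_lfunDr comp_lfunZr.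
- by move=> f; apply/lfunP=> x; rewrite !lfun_simp /= act1.
- by move=> a b f; apply/lfunP=> x; rewrite !lfun_simp /= actM.
Defined.

(** Hom_K(M, -) is the right adjoint of P |-> P (x)_A M from bimodules to left modules; it lets
    adjunction arguments run without tensor products. *)
Definition khom_bimod (M Z : fdmod A) : fdbimod A.
Proof.
refine (@Fdbimod K A (khom_mod M Z)
  (fun f b => ((f : 'Hom(M, Z)) \o linfun (act b))%VF) _ _ _ _ _).
- by move=> b k f g; rewrite comp_lfunDl comp_lfunZl.
- by move=> f k a b; apply/lfunP=> x; rewrite !lfun_simp /= act_linlP linearP.
- by move=> f; apply/lfunP=> x; rewrite !lfun_simp /= act1.
- by move=> f a b; apply/lfunP=> x; rewrite !lfun_simp /= actM.
- by move=> a b f; apply/lfunP=> x; rewrite !lfun_simp /=.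
Defined.

Lemma khom_precomp_bihom (M N Z : fdmod A) (i : 'Hom(M, N)) : is_hom i ->
  @is_bihom K A (khom_bimod N Z) (khom_bimod M Z) (precomp Z i).
Proof.
move=> iH; split=> [a f|f a]; rewrite !precompE; apply/lfunP=> x.
  by rewrite !lfun_simp.
by rewrite !lfun_simp /= iH.
Qed.

Lemma khom_postcomp_bihom (Z M N : fdmod A) (g : 'Hom(M, N)) : is_hom g ->
  @is_bihom K A (khom_bimod Z M) (khom_bimod Z N) (postcomp Z g).
Proof.
move=> gH; split=> [a f|f a]; rewrite !postcompE; apply/lfunP=> x.
  by rewrite !lfun_simp /= gH.
by rewrite !lfun_simp.
Qed.

(* The extension problem along M -> N is transposed, through
   Hom_A(M, Hom_A(P, Z)) = Hom_{A^e}(P, Hom_K(M, Z)), to a lifting problem. *)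
Lemma homA_mod_injective P Z : bimod_projective P -> mod_injective (homA_mod P Z).
Proof.
move=> Pp M N i f iH fH i0.
pose F p m : Z := homA_val (f m) p.
have Fl p : linear (F p) by move=> k x y; rewrite /F !linearP !lfun_simp.
pose Fm p := lfun_of (Fl p).
have FmE p m : Fm p m = homA_val (f m) p by rewrite lfun_ofE.
have FL : linear (Fm : P -> khom_bimod M Z).
  by move=> k p q; apply/lfunP=> m; rewrite !lfun_simp !FmE linearP.
pose G := lfun_of FL.
have GE p m : (G p : 'Hom(M, Z)) m = homA_val (f m) p by rewrite lfun_ofE FmE.
have GB : is_bihom G.
  split=> [a p|p a]; apply/lfunP=> m; rewrite GE.
    by rewrite homA_valP !lfun_simp /= GE.
  by rewrite !lfun_simp /= GE fH homA_actE.
(* [i] splits over K, so restriction along it is onto. *)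
have iS : limg (precomp Z i) = fullv.
  apply/eqP; rewrite eqEsubv subvf; apply/subvP=> g _; apply/memv_imgP.
  exists (g \o i^-1)%VF; rewrite ?memvf // precompE -comp_lfunA.
  by rewrite lker0_compVf ?comp_lfun1r //; apply/eqP.
have [H [HB HG]] := Pp _ _ _ G (khom_precomp_bihom Z iH) GB iS.
pose h n p : Z := (H p : 'Hom(N, Z)) n.
have hL n : linear (h n) by move=> k p q; rewrite /h linearP !lfun_simp.
pose hl n : 'Hom(P, Z) := lfun_of (hL n).
have hlE n p : hl n p = (H p : 'Hom(N, Z)) n by rewrite lfun_ofE.
have hA n : is_hom (hl n) by move=> a p; rewrite !hlE HB.1 !lfun_simp.
pose h' n : homA_mod P Z := homA_Mod (hl n).
have hE n p : homA_val (h' n) p = (H p : 'Hom(N, Z)) n by rewrite homA_ModK ?hlE.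
have h'L : linear h'.
  move=> k x y; apply: homA_mod_ext => p.
  by rewrite linearP !lfun_simp !hE linearP.
exists (lfun_of h'L); split.
  move=> a n; rewrite !lfun_ofE; apply: homA_mod_ext => p.
  by rewrite homA_actE !hE HB.2 !lfun_simp.
apply/lfunP=> m; rewrite comp_lfunE lfun_ofE; apply: homA_mod_ext => p.
by rewrite hE -GE -HG comp_lfunE precompE comp_lfunE.
Qed.

(* The forgetful functor from bimodules to left modules has the exact right
   adjoint M |-> Hom_K(A, M). *)
Lemma bimod_projective_left P : bimod_projective P -> mod_projective P.
Proof.
move=> Pp M N g f gH fH gS.
pose F p a : N := f (ract p a).
have Fl p : linear (F p) by move=> k a b; rewrite /F ract_linr linearP.
pose Fm p := lfun_of (Fl p).
have FmE p a : Fm p a = f (ract p a) by rewrite lfun_ofE.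
have FL : linear (Fm : P -> khom_bimod (reg_mod A) N).
  by move=> k p q; apply/lfunP=> a; rewrite !lfun_simp !FmE ract_linl linearP.
pose G := lfun_of FL.
have GE p a : (G p : 'Hom(A, N)) a = f (ract p a) by rewrite lfun_ofE FmE.
have GB : is_bihom G.
  split=> [a p|p a]; apply/lfunP=> b; rewrite GE.
    by rewrite -act_ract fH !lfun_simp /= GE.
  by rewrite -ractM !lfun_simp /= GE.
have iS : limg (postcomp (reg_mod A) g) = fullv.
  apply/eqP; rewrite eqEsubv subvf; apply/subvP=> u _; apply/memv_imgP.
  exists (g^-1 \o u)%VF; rewrite ?memvf // postcompE.
  by apply/lfunP=> x; rewrite !comp_lfunE lfun_surjK.
have [H [HB HG]] := Pp _ _ _ G (khom_postcomp_bihom (reg_mod A) gH) GB iS.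
(* The counit of the adjunction is evaluation at 1. *)
pose h p : M := (H p : 'Hom(A, M)) 1.
have hL : linear h by move=> k p q; rewrite /h linearP !lfun_simp.
exists (lfun_of hL).
split=> [a p|]; first by rewrite !lfun_ofE /h HB.1 !lfun_simp.
apply/lfunP=> p; rewrite comp_lfunE lfun_ofE /h -comp_lfunE -postcompE.
by rewrite -[postcomp _ _ _]comp_lfunE HG GE ract1.
Qed.

(** As a left module L is free on the preimage of 1 under [e], so evaluation there identifies
    Hom_A(L, Z) with Z as a vector space. The right action of [b] on L becomes the action of [phi b]
    on Z, which [t] matches with that of [b] on Y. *)
Lemma homA_mod_rank1 L Z (Y : fdmod A) (phi : A -> A)
    (e : 'Hom(L, A)) (t : 'Hom(Y, Z)) :
  @is_hom K A L (reg_mod A) e -> bijective e ->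
  (forall x b, e (ract x b) = e x * phi b) -> bijective t ->
  (forall b (y : Y), t (act b y) = act (phi b) (t y)) ->
  mod_iso Y (homA_mod L Z).
Proof.
move=> eH eB eR tB tH; have [e' eK e'K] := eB.
pose f y x : Z := act (e x) (t y).
have fL y : linear (f y) by move=> k u v; rewrite /f linearP act_linlP.
pose F y : 'Hom(L, Z) := lfun_of (fL y).
have FE y x : F y x = act (e x) (t y) by rewrite lfun_ofE.
have FA y : is_hom (F y) by move=> a x; rewrite !FE eH -actM.
pose G y : homA_mod L Z := homA_Mod (F y).
have GE y x : homA_val (G y) x = act (e x) (t y) by rewrite homA_ModK ?FE.
have GL : linear G.
  move=> k u v; apply: homA_mod_ext => x.
  by rewrite linearP !lfun_simp !GE !linearP.
exists (lfun_of GL); split.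
  move=> b y; rewrite !lfun_ofE; apply: homA_mod_ext => x.
  by rewrite homA_actE !GE eR tH actM.
have [t' tK t'K] := tB.
exists (fun u => t' (homA_val u (e' 1))) => [y|u]; rewrite lfun_ofE.
  by rewrite GE e'K act1 tK.
apply: homA_mod_ext => x; rewrite GE t'K -homA_valP; congr (homA_val u _).
by apply: (can_inj eK); rewrite eH /= e'K mulr1.
Qed.

Lemma bimod_iso_sym M N : bimod_iso M N -> bimod_iso N M.
Proof.
case=> f [[fH fR] fB]; have f0 := bij_lker0 fB; have fS := bij_limg fB.
have fK := lfun_surjK fS; exists f^-1%VF; split; last first.
  by exists f => // x; apply: (bij_inj fB); rewrite fK.
by split=> [a x|x a]; apply: (bij_inj fB); rewrite ?fH ?fR !fK.
Qed.

Lemma short_exact_split L P M (i : 'Hom(L, P)) (p : 'Hom(P, M)) :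
  short_exact i p -> mod_projective M ->
  exists r : 'Hom(P, L), is_hom r /\ (r \o i = \1)%VF.
Proof.
case=> iH pH i0 ip pS Mp.
have [s [sH ps]] := Mp _ _ p _ pH (@is_hom_id K A M) pS.
have [||r [rH ir]] := @is_hom_factor_inj K A P L P i (\1 - (s \o p))%VF iH _ i0.
- by apply: is_hom_sub; [apply: is_hom_id|apply: is_hom_comp].
- rewrite ip -comp_lfun_eq0 comp_lfunDr comp_lfunNr comp_lfun1r comp_lfunA ps.
  by rewrite comp_lfun1l subrr.
exists r; split=> //; apply/lfunP=> x; move/eqP/lker0P: i0; apply.
rewrite comp_lfunE -[LHS]comp_lfunE ir !lfun_simp /=.
suff /eqP-> : p (i x) == 0 by rewrite linear0 subr0.
by rewrite -memv_ker -ip memv_img ?memvf.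
Qed.

Lemma retract_projective (L P : fdmod A) (i : 'Hom(L, P)) (r : 'Hom(P, L)) :
  is_hom i -> is_hom r -> (r \o i = \1)%VF -> mod_projective P -> mod_projective L.
Proof.
move=> iH rH ri Pp M N g f gH fH gS.
have [h [hH gh]] := Pp _ _ g _ gH (is_hom_comp rH fH) gS.
exists (h \o i)%VF; split; first exact: is_hom_comp.
by rewrite comp_lfunA gh -comp_lfunA ri comp_lfun1r.
Qed.

(** One step of the coresolution. Left projectivity of L splits the projective cover as left
    modules; the syzygy N inherits it, so the step can be iterated. *)
Lemma syzygy_homA_mod L N Z : is_syzygy L N -> mod_projective L ->
  mod_projective N /\
  exists J, mod_injective J /\
  exists (p : 'Hom(homA_mod L Z, J)) (i : 'Hom(J, homA_mod N Z)), short_exact p i.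
Proof.
case=> P [p [i [[Pp pB pS _] iB i0 ip]]] Lp.
have [[pH _] [iH _]] := (pB, iB).
have ses : short_exact i p by [].
have [r [rH ri]] := short_exact_split ses Lp.
split; first exact: retract_projective iH rH ri (bimod_projective_left Pp).
exists (homA_mod P Z); split; first exact: homA_mod_injective.
by exists (homA_pull Z p), (homA_pull Z i); apply: homA_pull_exact rH ri.
Qed.

End HomModule.

(** * The Frobenius form of A and the pairing of Hom(X, nu J) with Hom(J, X) *)

Lemma dual_actE (K : fieldType) (A : falgType K) (M : fdbimod A) a
    (f : dual_bimod M) x :
  (act a f : 'Hom(M, K^o)) x = (f : 'Hom(M, K^o)) (ract x a).
Proof. by rewrite comp_lfunE lfunE. Qed.

Lemma dual_ractE (K : fieldType) (A : falgType K) (M : fdbimod A) a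
    (f : dual_bimod M) x :
  (ract f a : 'Hom(M, K^o)) x = (f : 'Hom(M, K^o)) (act a x).
Proof. by rewrite comp_lfunE lfunE. Qed.

Section Frobenius.
Variables (K : fieldType) (A : falgType K) (eta : algaut A).
Variable theta : 'Hom(dual_bimod (reg_bimod A),
                      twist_bimod (aut_inv eta) (reg_bimod A)).
Hypotheses (thetaB : is_bihom theta) (theta_bij : bijective theta).
Implicit Types M X J V : fdmod A.

Notation nu := (twist_mod (aut_inv eta)).

Definition frob_theta : 'Hom(A, K^o) -> A := theta.

(** The Frobenius form: the functional that corresponds to 1 under D(A) = A twisted by eta^-1. *)
Definition frob_form : 'Hom(A, K^o) := theta^-1%VF (1 : A).

Local Notation lambda := frob_form.

Lemma frob_thetaM (f g : 'Hom(A, K^o)) a :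
  (forall x, g x = f (x * a)) -> frob_theta g = eta a * frob_theta f.
Proof.
move=> fg; rewrite -[RHS](thetaB.1 a f); congr frob_theta.
by apply/lfunP=> x; rewrite fg; exact: (esym (@dual_actE K A (reg_bimod A) a f x)).
Qed.

Lemma frob_theta_ract (f g : 'Hom(A, K^o)) a :
  (forall x, g x = f (a * x)) -> frob_theta g = frob_theta f * a.
Proof.
move=> fg; rewrite -[RHS](thetaB.2 f a); congr frob_theta.
by apply/lfunP=> x; rewrite fg; exact: (esym (@dual_ractE K A (reg_bimod A) a f x)).
Qed.

Lemma frob_theta_inj : injective frob_theta.
Proof. exact: bij_inj theta_bij. Qed.

Lemma frob_theta_form : frob_theta lambda = 1.
Proof. exact/lfun_surjK/bij_limg. Qed.

(** [f] is [lambda] composed with left multiplication by [frob_theta f], since both have the same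
    image under [theta]; evaluate at 1. *)
Lemma frob_formE f : lambda (frob_theta f) = f 1.
Proof.
have fE : f = (lambda \o amull (frob_theta f))%VF.
  apply: frob_theta_inj; rewrite [RHS](@frob_theta_ract lambda _ (frob_theta f)).
    by rewrite frob_theta_form mul1r.
  by move=> x; rewrite comp_lfunE lfunE.
by rewrite [in RHS]fE comp_lfunE lfunE /= mulr1.
Qed.

(** As functionals of [x], both sides have [theta]-image [eta a]: the left action on the target is
    twisted, the right one is not. *)
Lemma frob_formC x a : lambda (x * a) = lambda (eta a * x).
Proof.
have : (lambda \o amulr a)%VF = (lambda \o amull (eta a))%VF.
  apply: frob_theta_inj; rewrite [LHS](@frob_thetaM lambda _ a).
    rewrite [RHS](@frob_theta_ract lambda _ (eta a)) ?frob_theta_form ?mulr1 ?mul1r //.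
    by move=> y; rewrite comp_lfunE lfunE.
  by move=> y; rewrite comp_lfunE lfunE.
by move/lfunP/(_ x); rewrite !comp_lfunE !lfunE.
Qed.

Lemma frob_form_nondeg a : (forall x, lambda (a * x) = 0) -> a = 0.
Proof.
move=> a0; rewrite -[a]mul1r -frob_theta_form -(@frob_theta_ract _ 0).
  exact: (linear0 theta).
by move=> x; rewrite zero_lfunE a0.
Qed.

(* For a functional xi on M, the unique hom g : M -> nu A with lambda g = xi. *)
Definition frob_lift_fun M (xi : 'Hom(M, K^o)) (x : M) : A :=
  frob_theta (xi \o lfun_of (@act_linl K A M x))%VF.

Fact frob_lift_linear M (xi : 'Hom(M, K^o)) : linear (frob_lift_fun xi).
Proof.
move=> k x y; rewrite /frob_lift_fun -[RHS](linearP theta) /=; congr frob_theta.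
by apply/lfunP=> a; rewrite !lfun_simp /= !lfun_ofE !linearP.
Qed.

Definition frob_lift M (xi : 'Hom(M, K^o)) : 'Hom(M, A) :=
  lfun_of (frob_lift_linear xi).

Lemma frob_lift_hom M (xi : 'Hom(M, K^o)) a x :
  frob_lift xi (act a x) = eta a * frob_lift xi x.
Proof.
rewrite !lfun_ofE; apply: frob_thetaM => b.
by rewrite !comp_lfunE !lfun_ofE actM.
Qed.

Lemma frob_form_lift M (xi : 'Hom(M, K^o)) x : lambda (frob_lift xi x) = xi x.
Proof. by rewrite lfun_ofE frob_formE comp_lfunE lfun_ofE act1. Qed.

Definition free_retract J : Prop :=
  exists n (i : 'Hom(J, free_mod A n)) (r : 'Hom(free_mod A n, J)),
    [/\ is_hom i, is_hom r & (r \o i = \1)%VF].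

(** Each coordinate form of J lifts to a hom J -> nu A; undoing the twist gives a hom J -> A.
    Together they embed J in a free module, because [lambda] recovers the coordinates, and
    injectivity of J splits the embedding. *)
Lemma injective_free_retract J : mod_injective J -> free_retract J.
Proof.
move=> Ji; pose xi k : 'Hom(J, K^o) := coord_form k.
pose f x : free_mod A (\dim {:J}) :=
  [ffun k => aut_inv eta (frob_lift (xi k) x)] : {ffun _ -> A}.
have fL : linear f by move=> k x y; apply/ffunP=> l; rewrite !ffunE !linearP.
have iH : is_hom (lfun_of fL).
  move=> a x; rewrite !lfun_ofE; apply/ffunP=> k.
  by rewrite !ffunE frob_lift_hom rmorphM /= aut_funK.
have [|r [rH ri]] := Ji _ _ (lfun_of fL) \1%VF iH (@is_hom_id K A J).
  apply/eqP; rewrite -subv0; apply/subvP=> x; rewrite memv_ker lfun_ofE memv0.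
  move=> /eqP/ffunP fx; rewrite (coord_vbasis (memvf x)) big1 // => k _.
  have := fx k; rewrite !ffunE => /(congr1 eta); rewrite linear0 aut_invfunK => x0.
  have := frob_form_lift (xi k) x; rewrite x0 linear0 lfun_ofE => <-.
  by rewrite scale0r.
by exists _, (lfun_of fL), r.
Qed.

Lemma free_retract_projective J : free_retract J -> mod_projective J.
Proof.
case=> n [i [r [iH rH ri]]]; apply: retract_projective iH rH ri _.
exact: free_mod_projective.
Qed.

Lemma free_mod_gen n (u : free_mod A n) :
  u = \sum_i act ((u : {ffun 'I_n -> A}) i) (free_gen A i).
Proof.
apply/ffunP=> j; rewrite sum_ffunE (bigD1 j) //= big1 ?addr0 => [|i ij].
  by rewrite !ffunE eqxx mulr1.
by rewrite !ffunE (negPf ij) mulr0.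
Qed.

Lemma free_homE n X (f : 'Hom(free_mod A n, X)) u : is_hom f ->
  f u = \sum_i act ((u : {ffun 'I_n -> A}) i) (f (free_gen A i)).
Proof.
move=> fH; rewrite {1}[u]free_mod_gen linear_sum.
by apply: eq_bigr => i _; apply: fH.
Qed.

(* The trace of the endomorphism g h of A^n, through the form lambda. *)
Definition frob_pair n X (g : 'Hom(X, free_mod A n))
    (h : 'Hom(free_mod A n, X)) : K^o :=
  \sum_(k < n) lambda ((g (h (free_gen A k)) : {ffun 'I_n -> A}) k).

Lemma frob_pair_linl n X (h : 'Hom(free_mod A n, X)) : linear ((@frob_pair n X)^~ h).
Proof.
move=> k f g; rewrite /frob_pair scaler_sumr -big_split /=; apply: eq_bigr => i _.
by rewrite !lfun_simp !ffunE linearP.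
Qed.

Lemma frob_pair_linr n X (g : 'Hom(X, free_mod A n)) : linear (frob_pair g).
Proof.
move=> k f h; rewrite /frob_pair scaler_sumr -big_split /=; apply: eq_bigr => i _.
by rewrite !lfun_simp linearP !ffunE linearP.
Qed.

(** Symmetry of the trace. Expanding in matrix entries of [f], [frob_formC] moves each entry to the
    left as its image under [eta], and the twisted linearity of [g] absorbs it. *)
Lemma frob_pair_natural n m X (f : 'Hom(free_mod A n, free_mod A m))
    (g : 'Hom(X, nu (free_mod A n))) (h : 'Hom(free_mod A m, X)) :
  is_hom f -> is_hom g -> is_hom h -> frob_pair (f \o g)%VF h = frob_pair g (h \o f)%VF.
Proof.
move=> fH gH hH.
pose F i j := (f (free_gen A i) : {ffun _ -> A}) j.
transitivity (\sum_(j < m) \sum_(i < n)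
    lambda ((g (act (F i j) (h (free_gen A j))) : {ffun _ -> A}) i)).
  apply: eq_bigr => j _; rewrite comp_lfunE (free_homE _ fH) sum_ffunE linear_sum.
  by apply: eq_bigr => i _; rewrite gH !ffunE /= frob_formC.
rewrite exchange_big; apply: eq_bigr => i _.
rewrite comp_lfunE (free_homE _ hH) linear_sum sum_ffunE linear_sum.
by [].
Qed.

(** Pairing [g] with the hom sending the k-th generator to [x] and the others to 0 yields [lambda]
    of the k-th component of [g x]. With [act a x] for [x], [frob_formC] reduces to nondegeneracy of
    [lambda]. *)
Lemma frob_pair_nondegl n X (g : 'Hom(X, nu (free_mod A n))) : is_hom g ->
  (forall h : 'Hom(free_mod A n, X), is_hom h -> frob_pair g h = 0) -> g = 0.
Proof.
move=> gH g0; suff l0 x k : lambda ((g x : {ffun _ -> A}) k) = 0.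
  apply/lfunP=> x; rewrite zero_lfunE; apply/ffunP=> k; rewrite ffunE.
  apply: frob_form_nondeg => a; rewrite frob_formC.
  by have := l0 (act a x) k; rewrite gH ffunE.
pose h := free_map (fun j => if j == k then x else 0).
have := g0 h (@free_map_hom _ _ _ _ _).
rewrite /frob_pair (bigD1 k) //= big1 => [|j jk].
  rewrite addr0 free_mapE (bigD1 k) //= big1 => [|i ik]; last by rewrite (negPf ik) linear0.
  by rewrite !ffunE !eqxx act1 addr0.
rewrite free_mapE big1 ?linear0 ?ffunE ?linear0 // => i _.
have [->|ik] := eqVneq i k; last by rewrite linear0.
by rewrite ffunE (negPf jk) act0.
Qed.

(** Placing the lift of the l-th coordinate form of X in component [k] gives a test hom whose
    pairing with [h] is the l-th coordinate of [h] at the k-th generator. *)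
Lemma frob_pair_nondegr n X (h : 'Hom(free_mod A n, X)) : is_hom h ->
  (forall g : 'Hom(X, nu (free_mod A n)), is_hom g -> frob_pair g h = 0) -> h = 0.
Proof.
move=> hH h0; apply: free_mod_ext => // [a x|k].
  by rewrite !zero_lfunE linear0.
rewrite zero_lfunE (coord_vbasis (memvf (h _))) big1 // => l _.
pose xi : 'Hom(X, K^o) := coord_form l.
pose f x : free_mod A n := [ffun j => if j == k then frob_lift xi x else 0] : {ffun _ -> A}.
have fL : linear f.
  move=> c x y; apply/ffunP=> j; rewrite !ffunE; case: (j == k); first exact: linearP.
  by rewrite scaler0 addr0.
have := h0 (lfun_of fL); rewrite /frob_pair (bigD1 k) //= big1 => [|j jk].
  rewrite addr0 lfun_ofE ffunE eqxx frob_form_lift lfun_ofE => -> //; first exact: scale0r.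
  move=> a x; rewrite !lfun_ofE; apply/ffunP=> j; rewrite !ffunE.
  by case: (j == k); rewrite ?frob_lift_hom ?mulr0.
by rewrite lfun_ofE ffunE (negPf jk) linear0.
Qed.

Section Pairing.
Variables (X J : fdmod A) (n : nat).
Variables (i : 'Hom(J, free_mod A n)) (r : 'Hom(free_mod A n, J)).
Hypotheses (iH : is_hom i) (rH : is_hom r) (ri : (r \o i = \1)%VF).

Definition retract_pair (g : 'Hom(X, J)) (h : 'Hom(J, X)) : K^o :=
  frob_pair (i \o g)%VF (h \o r)%VF.

Lemma retract_pair_linl h : linear (retract_pair^~ h).
Proof.
by move=> k f g; rewrite /retract_pair comp_lfunDr -comp_lfunZr frob_pair_linl.
Qed.

Lemma retract_pair_linr g : linear (retract_pair g).
Proof.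
by move=> k f h; rewrite /retract_pair comp_lfunDl -comp_lfunZl frob_pair_linr.
Qed.

Lemma retract_pair_nondegl (g : 'Hom(X, J)) : @is_hom K A X (nu J) g ->
  (forall h : 'Hom(J, X), is_hom h -> retract_pair g h = 0) -> g = 0.
Proof.
move=> gH g0; have igH : @is_hom K A X (nu (free_mod A n)) (i \o g)%VF.
  exact: is_hom_comp gH (twist_hom (phi := aut_inv eta) iH).
suff ig0 : (i \o g = 0)%VF.
  by rewrite -[LHS]comp_lfun1l -ri -comp_lfunA ig0 comp_lfun0r.
apply: (frob_pair_nondegl igH) => h hH.
have irH := is_hom_comp rH iH.
(* The idempotent [i \o r] is inserted so that naturality can move it across the pairing, where it
   makes the test map factor through J. *)
have -> : (i \o g = (i \o r) \o (i \o g))%VF.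
  by rewrite -comp_lfunA; congr (i \o _)%VF; rewrite comp_lfunA ri comp_lfun1l.
rewrite (frob_pair_natural irH igH hH) comp_lfunA.
by apply: g0; apply: is_hom_comp.
Qed.

Lemma retract_pair_nondegr (h : 'Hom(J, X)) : is_hom h ->
  (forall g : 'Hom(X, J), @is_hom K A X (nu J) g -> retract_pair g h = 0) -> h = 0.
Proof.
move=> hH h0; have hrH := is_hom_comp rH hH.
suff hr0 : (h \o r = 0)%VF.
  by rewrite -[LHS]comp_lfun1r -ri comp_lfunA hr0 comp_lfun0l.
apply: (frob_pair_nondegr hrH) => g gH.
have irH := is_hom_comp rH iH.
have -> : (h \o r = (h \o r) \o (i \o r))%VF.
  by rewrite comp_lfunA -[((h \o r) \o i)%VF]comp_lfunA ri comp_lfun1r.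
rewrite -(frob_pair_natural irH gH hrH) -comp_lfunA.
exact/h0/(is_hom_comp gH (twist_hom (phi := aut_inv eta) rH)).
Qed.

Lemma retract_dim : \dim (homA X (nu J)) = \dim (homA J X).
Proof.
apply/eqP; rewrite eqn_leq; apply/andP; split.
  have := @pairing_dim K _ _ retract_pair (homA X (nu J)) 0%VS (homA J X).
  rewrite dimv0 addn0; apply => [g|h|g /(@mem_homA K A X (nu J)) gH g0].
  - exact: retract_pair_linr.
  - exact: retract_pair_linl.
  rewrite memv0; apply/eqP/retract_pair_nondegl=> // h hH.
  exact/g0/mem_homA.
have := @pairing_dim K _ _ (fun h g => retract_pair g h) (homA J X) 0%VS (homA X (nu J)).
rewrite dimv0 addn0; apply => [h|g|h /mem_homA hH h0].
- exact: retract_pair_linl.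
- exact: retract_pair_linr.
rewrite memv0; apply/eqP/retract_pair_nondegr=> // g gH.
exact/h0/(@mem_homA K A X (nu J)).
Qed.

End Pairing.

Lemma free_retract_dim X J : free_retract J -> \dim (homA X (nu J)) = \dim (homA J X).
Proof. by case=> n [i [r [iH rH ri]]]; apply: retract_dim ri. Qed.

(* The maps induced by [f] on Hom(X, nu -) and Hom(-, X) are adjoint for the
   pairings above, hence of the same rank. *)
Lemma nakayama_dim X V J J' V' (i : 'Hom(V, J)) (f : 'Hom(J, J')) (q : 'Hom(J', V')) :
  is_hom i -> is_hom f -> is_hom q -> lker i = 0%VS -> limg i = lker f ->
  limg f = lker q -> limg q = fullv -> free_retract J -> free_retract J' ->
  (\dim (homA X (nu V)) + \dim (homA J' X) = \dim (homA J X) + \dim (homA V' X))%N.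
Proof.
move=> iH fH qH i0 if_ fq qS JF JF'.
have dJ := free_retract_dim X JF; have dJ' := free_retract_dim X JF'.
case: JF JF' => n [j [r [jH rH rj]]] [n' [j' [r' [jH' rH' rj']]]].
have fpull := dim_ker_precomp X qH qS fq.
have npush : (postcomp X i @: homA X (nu V) = homA X (nu J) :&: lker (postcomp X f))%VS.
  exact: (@homA_postcomp K A J' X (nu V) (nu J) i f (twist_hom iH) i0 if_).
have dpush := @dim_postcomp K A X (nu V) (nu J) i i0.
have fpush : (\dim (homA X (nu V)) + \dim (postcomp X f @: homA X (nu J))
    = \dim (homA X (nu J)))%N.
  by rewrite -dpush npush limg_ker_dim.
(* Inserting [r \o j = 1] replaces [f] by the map [j' \o f \o r] of free modules, to which
   [frob_pair_natural] applies. *)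
have adj (g : 'Hom(X, J)) (h : 'Hom(J', X)) : @is_hom K A X (nu J) g -> is_hom h ->
    retract_pair j' r' (f \o g)%VF h = retract_pair j r g (h \o f)%VF.
  move=> gH hH; have jgH : @is_hom K A X (nu (free_mod A n)) (j \o g)%VF.
    exact: is_hom_comp gH (twist_hom (phi := aut_inv eta) jH).
  have jfrH := is_hom_comp rH (is_hom_comp fH jH').
  rewrite /retract_pair -!comp_lfunA.
  have -> : (j' \o (f \o g) = ((j' \o f) \o r) \o (j \o g))%VF.
    by rewrite !comp_lfunA -[(((j' \o f) \o r) \o j)%VF]comp_lfunA rj comp_lfun1r.
  rewrite (frob_pair_natural jfrH jgH (is_hom_comp rH' hH)) !comp_lfunA.
  by rewrite -[((h \o r') \o j')%VF]comp_lfunA rj' comp_lfun1r.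
(* If [g] annihilates all [h \o f], adjointness and nondegeneracy for J' give [f \o g = 0], so [g]
   comes from Hom(X, nu V). *)
have le1 : (\dim (postcomp X f @: homA X (nu J)) <= \dim (precomp X f @: homA J' X))%N.
  rewrite -(leq_add2l (\dim (homA X (nu V)))) fpush addnC -dpush.
  apply: (@pairing_dim K _ _ (retract_pair j r)) => [g|h|g /(@mem_homA K A X (nu J)) gH g0].
  - exact: retract_pair_linr.
  - exact: retract_pair_linl.
  rewrite npush memv_cap memv_ker postcompE.
  apply/andP; split; first exact/(@mem_homA K A X (nu J)).
  apply/eqP/(retract_pair_nondegl jH' rH' rj').
    exact: is_hom_comp gH (twist_hom (phi := aut_inv eta) fH).
  move=> h hH; rewrite adj //; apply: g0; apply/memv_imgP.
  by exists h; [apply/mem_homA|rewrite precompE].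
have le2 : (\dim (precomp X f @: homA J' X) <= \dim (postcomp X f @: homA X (nu J)))%N.
  rewrite -(leq_add2l (\dim (homA V' X))) fpull addnC -(dim_precomp X qS).
  apply: (@pairing_dim K _ _ (fun h g => retract_pair j' r' g h)) => [h|g|h /mem_homA hH h0].
  - exact: retract_pair_linl.
  - exact: retract_pair_linr.
  rewrite (homA_precomp X qH qS fq).
  rewrite memv_cap memv_ker precompE; apply/andP; split; first exact/mem_homA.
  apply/eqP/(retract_pair_nondegr jH rH rj); first exact: is_hom_comp.
  move=> g gH; rewrite -adj //; apply: h0; apply/memv_imgP.
  by exists g; [apply/(@mem_homA K A X (nu J))|rewrite postcompE].
have rk : \dim (postcomp X f @: homA X (nu J)) = \dim (precomp X f @: homA J' X).
  by apply/eqP; rewrite eqn_leq le1.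
by rewrite -fpull -dJ -fpush rk addnCA addnC -addnA.
Qed.

End Frobenius.

(** * Projectivity of A and transport of exact sequences along isomorphisms *)

Section Splicing.
Variables (K : fieldType) (A : falgType K).
Implicit Types U V W P X Y J : fdmod A.

Lemma reg_mod_projective : mod_projective (reg_mod A).
Proof.
move=> M N g f gH fH gS; pose h := lfun_of (act_linl (g^-1%VF (f 1))).
exists h; split=> [a x|]; first by rewrite !lfun_ofE actM.
by apply/lfunP=> x; rewrite comp_lfunE lfun_ofE gH lfun_surjK // -fH /= mulr1.
Qed.

Lemma mod_projective_iso P X : mod_iso P X -> mod_projective P -> mod_projective X.
Proof.
case=> f [fH fB].
have [||g [gH fg]] := @is_hom_factor_inj K A X P X f \1%VF fH _ (bij_lker0 fB).
- exact: is_hom_id.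
- by rewrite (bij_limg fB) subvf.
exact: retract_projective fg.
Qed.

Lemma lker_comp_inj P X J (p : 'Hom(P, X)) (j : 'Hom(X, J)) :
  lker j = 0%VS -> lker (j \o p)%VF = lker p.
Proof.
move=> j0; apply/vspaceP=> x; rewrite !memv_ker comp_lfunE -[LHS]memv_ker j0.
by rewrite memv0.
Qed.

Lemma short_exact_iso U P X Y (i : 'Hom(U, P)) (p : 'Hom(P, X)) (t : 'Hom(X, Y)) :
  short_exact i p -> is_hom t -> bijective t -> short_exact i (t \o p)%VF.
Proof.
case=> iH pH i0 ip pS tH tB; split=> //; first exact: is_hom_comp.
  by rewrite (lker_comp_inj _ (bij_lker0 tB)).
by rewrite limg_comp pS bij_limg.
Qed.

End Splicing.

(** * Splicing the coresolution of Z and counting dimensions *)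

Theorem proposition4p4 (K : closedFieldType) (A : falgType K)
    (mu eta : algaut A) (Omega3 : fdbimod A) (X Y : fdmod A) :
  self_injective A ->
  is_nsyzygy 3 (reg_bimod A) Omega3 ->
  bimod_iso Omega3 (twist_bimod mu (reg_bimod A)) ->
  nakayama_aut eta ->
  equivariant (aut_comp (aut_inv eta) mu) Y ->
  viso (vdual (Ext 1 Y X)) (Ext 1 X Y).
Proof.
move=> _ [L2 [[L1 [[L0 [L0A S0]] S1]] S2]] [e3 [[e3H e3R] e3B]].
move=> [theta [thetaB theta_bij]] [g [gH gB]].
have retr := injective_free_retract thetaB theta_bij.
pose Z := twist_mod mu Y; pose nu := twist_mod (aut_inv eta).
have [e0 [[e0H e0R] e0B]] := bimod_iso_sym L0A.
have L0p : mod_projective L0.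
  case: L0A => u [[uH _] uB].
  by apply: mod_projective_iso (@reg_mod_projective K A); exists u.
(* With V_i = Hom_A(L_i, Z) for i < 3 and V_3 = Hom_A([Omega3], Z), these are the sequences 0 -> V_i
   -> J_i -> V_(i+1) -> 0. *)
have [L1p [J0 [J0i [p0 [i0 ses0]]]]] := syzygy_homA_mod Z S0 L0p.
have [L2p [J1 [J1i [p1 [i1 ses1]]]]] := syzygy_homA_mod Z S1 L1p.
have [_ [J2 [J2i [p2 [i2 ses2]]]]] := syzygy_homA_mod Z S2 L2p.
have isoZ : mod_iso Z (homA_mod L0 Z).
  apply: (@homA_mod_rank1 _ _ L0 Z Z id e0 \1%VF) => //.
  - by exists id => x; rewrite id_lfunE.
  - by move=> b y; rewrite !id_lfunE.
(* Composing [e3] with [mu] untwists the left action but makes [b] act on the right through [mu b];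
   this cancels the twist in Z = _mu Y. *)
have isoY : mod_iso (homA_mod Omega3 Z) Y.
  apply/mod_iso_sym.
  pose muL := linfun (aut_fun mu).
  apply: (@homA_mod_rank1 _ _ Omega3 Z Y mu (muL \o e3)%VF (\1 : 'Hom(Y, Y))%VF).
  - by move=> a x; rewrite !comp_lfunE !lfunE e3H /= rmorphM /= aut_invfunK.
  - case: e3B => e3' e3K e3'K; exists (fun a => e3' (aut_invfun mu a)) => x.
      by rewrite comp_lfunE lfunE /= aut_funK e3K.
    by rewrite comp_lfunE lfunE /= e3'K aut_invfunK.
  - by move=> x b; rewrite !comp_lfunE !lfunE e3R /= rmorphM.
  - by exists id => x; rewrite id_lfunE.
  - by move=> b y; rewrite !id_lfunE /= aut_funK.
have [t3 [t3H t3B]] := isoY.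
have ses2' := short_exact_iso ses2 t3H t3B.
(* [nu Z] is by computation the twist of Y by [aut_comp (aut_inv eta) mu], so the equivariance
   isomorphism [g] applies directly. *)
have dY W : \dim (homA W (nu (homA_mod L0 Z))) = \dim (homA W Y).
  rewrite -(hom_dim_iso W (twist_iso (aut_inv eta) isoZ)).
  apply: hom_dim_iso. by exists g.
have Ext_XY := Ext1_dim X Y; have Ext_YX := Ext1_dim Y X.
have J2p := free_retract_projective (retr _ J2i).
(* V_2 replaces the free syzygy of Y, since J_2 is also projective. *)
have sch : (\dim (homA (free_syz Y 1) X) + \dim (homA J2 X)
    = \dim (homA (homA_mod L2 Z) X) + \dim (homA (free_res Y 0) X))%N.
  exact: (schanuel_dim X (free_syz_exact Y) ses2' (@free_mod_projective _ _ _) J2p).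
have dJ0 := free_retract_dim thetaB theta_bij X (retr _ J0i).
(* The free cover of X is played against the twisted sequence 0 -> nu V_0 -> nu J_0 -> nu V_1 -> 0,
   whose first term stands for Y. *)
have four : (\dim (homA (free_syz X 1) Y) + \dim (homA J0 X)
    = \dim (homA X (nu (homA_mod L1 Z))) + \dim (homA (free_res X 0) Y))%N.
  rewrite -dJ0 -!dY; exact: (proj_inj_dim (free_syz_exact X)
    (twist_exact (aut_inv eta) ses0) (@free_mod_projective _ _ _) (twist_injective J0i)).
case: ses0 ses1 ses2' => p0H i0H p00 pi0 i0S [p1H i1H p10 pi1 i1S] [p2H i2H p20 pi2 i2S].
have ar0 : (\dim (homA X Y) + \dim (homA J1 X)
    = \dim (homA J0 X) + \dim (homA (homA_mod L2 Z) X))%N.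
  rewrite -dY; apply: (@nakayama_dim _ _ _ _ thetaB theta_bij X _ _ _ _
    p0 (p1 \o i0)%VF i1) => //.
  - exact: is_hom_comp.
  - by rewrite lker_comp_inj.
  - by rewrite limg_comp i0S.
  - exact: retr.
  - exact: retr.
have ar1 : (\dim (homA X (nu (homA_mod L1 Z))) + \dim (homA J2 X)
    = \dim (homA J1 X) + \dim (homA Y X))%N.
  apply: (@nakayama_dim _ _ _ _ thetaB theta_bij X _ _ _ _
    p1 (p2 \o i1)%VF (t3 \o i2)%VF) => //.
  - exact: is_hom_comp.
  - by rewrite lker_comp_inj.
  - by rewrite limg_comp i1S.
  - exact: retr.
  - exact: retr.
apply: viso_dim; rewrite dimvf /dim /= muln1 -dimvf.
(* Both Ext dimensions equal hom(V_2, X) + hom(Y, X) - hom(J_2, X): for Ext^1(Y, X) by [sch], for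
   Ext^1(X, Y) by [four], [ar0] and [ar1] in turn. *)
clear -Ext_XY Ext_YX sch four ar0 ar1; lia.
Qed.
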